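(* Let $k$ be an infinite field, let $n\ge 4$ and let $A=\{0=a_0<a_1<\dots<a_{n-1}=d\}\subset\mathbb{N}$ with $\gcd(a_1,\dots,a_{n-1})=1$, and let $\sigma$ be the sumsets regularity of $A$. (1) If $\sigma=\operatorname{r}(k[\mathcal{C}_A])\ge\left\lceil\frac{c_1+c_2}{d}\right\rceil$, then $\sigma\le\operatorname{reg}(k[\mathcal{C}_A])\le\sigma+1$. (2) If $\sigma=\left\lceil\frac{c_1+c_2}{d}\right\rceil>\operatorname{r}(k[\mathcal{C}_A])$, then $\left\lceil\frac{\sigma}{2}\right\rceil+1\le\operatorname{reg}(k[\mathcal{C}_A])\le\sigma+1$.
   Context: $\mathbb{N}=\{0,1,2,\dots\}$. $k[\mathcal{C}_A]=k[x_0,\dots,x_{n-1}]/I(\mathcal{C}_A)$, where $I(\mathcal{C}_A)$ is the kernel of the $k$-algebra homomorphism $k[x_0,\dots,x_{n-1}]\to k[u,v]$, $x_i\mapsto u^{a_i}v^{d-a_i}$; it is standard graded ($\deg x_i=1$) and is the homogeneous coordinate ring of the projective monomial curve $\mathcal{C}_A\subset\mathbb{P}^{n-1}_k$. $\operatorname{reg}(k[\mathcal{C}_A])=\max\{j-i:\beta_{i,j}\ne0\}$ is its Castelnuovo-Mumford regularity ($\beta_{i,j}$ the graded Betti numbers over $k[x_0,\dots,x_{n-1}]$), and $\operatorname{r}(k[\mathcal{C}_A])$ is the regularity of its Hilbert function: the least integer $r$ such that its Hilbert function and Hilbert polynomial agree at every integer $s\ge r$. For $s\in\mathbb{N}$,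 $0A=\{0\}$ and $sA=\{a_{i_1}+\dots+a_{i_s}: 0\le i_1\le\dots\le i_s\le n-1\}$ for $s\ge1$. $\mathcal{S}_1$ and $\mathcal{S}_2$ are the numerical semigroups generated by $A$ and by $d-A=\{d-a: a\in A\}$; $c_i$ is the conductor of $\mathcal{S}_i$ (the least $c\in\mathbb{N}$ such that all integers $m\ge c$ lie in $\mathcal{S}_i$), and $C_i=\mathcal{S}_i\cap[0,c_i-2]$ (empty if $c_i<2$). The sumsets regularity $\sigma$ of $A$ is the least $\sigma\in\mathbb{N}$ such that for all $s\ge\sigma$ one has $sA=C_1\sqcup[c_1,sd-c_2]\sqcup(sd-C_2)$, where $\sqcup$ is disjoint union and $[c_1,sd-c_2]$ is the integer interval, this decomposition being understood to include the requirement $c_1\le sd-c_2$. *)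

(* Defs.v *)
From mathcomp Require Import all_boot all_order all_algebra.
From mathcomp Require Import mpoly.

Set Implicit Arguments.
Unset Strict Implicit.
Unset Printing Implicit Defensive.

Import Order.TTheory GRing.Theory Num.Theory.

Local Open Scope ring_scope.

(** * Sumsets and numerical semigroups *)

Definition sumset (A : seq nat) (s m : nat) : Prop :=
  exists2 t : s.-tuple nat, all (mem A) t & m = sumn t.

Definition generated_semigroup (A : seq nat) (m : nat) : Prop :=
  exists c : nat -> nat, m = (\sum_(a <- A) c a * a)%N.

(* d - A *)
Definition reflected (d : nat) (A : seq nat) : seq nat :=
  [seq (d - a)%N | a <- A].

Definition is_least (P : nat -> Prop) (m : nat) : Prop :=
  P m /\ forall m', P m' -> (m <= m')%N.

Definition is_conductor (S : nat -> Prop) : nat -> Prop :=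
  is_least (fun c => forall m, (c <= m)%N -> S m).

(* S `&` [0, c - 2], the subtraction being that of the integers, so that the
   set is empty when c < 2 *)
Definition initial_part (S : nat -> Prop) (c m : nat) : Prop :=
  S m /\ (m + 2 <= c)%N.

(* Under the inequality c1 + c2 <= s * d, i.e. c1 <= s * d - c2 over the
   integers, the truncated subtraction s * d - c2 is the integer one, and
   s * d - x is nonnegative for every x <= c2 - 2; hence it is enough to
   quantify over natural numbers m. *)
Definition sumset_decomposition (A : seq nat) (d c1 c2 s : nat) : Prop :=
  let C1 := initial_part (generated_semigroup A) c1 in
  let C2 := initial_part (generated_semigroup (reflected d A)) c2 in
  let middle := fun m => (c1 <= m <= s * d - c2)%N : Prop in
  let right := fun m => exists2 x, C2 x & (m + x = s * d)%N in
  [/\ (c1 + c2 <= s * d)%N,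
      forall m, sumset A s m <-> [\/ C1 m, middle m | right m],
      forall m, ~ (C1 m /\ middle m),
      forall m, ~ (C1 m /\ right m) &
      forall m, ~ (middle m /\ right m)].

Definition is_sumsets_regularity (A : seq nat) (d c1 c2 : nat) : nat -> Prop :=
  is_least (fun sigma =>
    forall s, (sigma <= s)%N -> sumset_decomposition A d c1 c2 s).

(** * The projective monomial curve *)

Definition infinite_field (k : fieldType) : Prop :=
  forall s : seq k, exists x, x \notin s.

(* The two variables u and v of k[u, v] are 'X_0 and 'X_1. *)
Definition curve_param (k : fieldType) (n : nat) (a : n.-tuple nat) (d : nat) :
    n.-tuple {mpoly k[2]} :=
  [tuple ('X_ord0 ^+ tnth a i * 'X_(lift ord0 ord0) ^+ (d - tnth a i))%R
    | i < n].

Definition toric_ideal (k : fieldType) (n : nat) (a : n.-tuple nat) (d : nat) :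
    pred {mpoly k[n]} :=
  [pred p | p \mPo curve_param k a d == 0].
Arguments toric_ideal k {n} a d.

(** * Hilbert function of S/I, for S = k[x_0, ..., x_(n-1)] and a homogeneous
    ideal I of S *)

(* dim_k (S_s / I_s) = h: the classes of some forms e_1, ..., e_h of degree s
   are a basis of S_s / I_s *)
Definition quotient_dim (k : fieldType) (n : nat) (I : pred {mpoly k[n]})
    (s h : nat) : Prop :=
  exists2 e : h.-tuple {mpoly k[n]},
    forall t, tnth e t \is s.-homog &
    forall p : {mpoly k[n]}, p \is s.-homog ->
      exists! c : 'rV[k]_h, I (p - \sum_(t < h) c 0 t *: tnth e t).

Definition is_hilbert_function (k : fieldType) (n : nat)
    (I : pred {mpoly k[n]}) (H : int -> nat) : Prop :=
  (forall s : nat, quotient_dim I s (H s%:Z)) /\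
  (forall s : int, s < 0 -> H s = 0%N).

Definition agree_from (H : int -> nat) (P : {poly rat}) (r : int) : Prop :=
  forall s : int, r <= s -> (H s)%:R = P.[s%:~R].

Definition is_hilbert_polynomial (H : int -> nat) (P : {poly rat}) : Prop :=
  exists r : int, agree_from H P r.

Definition is_hilbert_regularity (k : fieldType) (n : nat)
    (I : pred {mpoly k[n]}) (r : int) : Prop :=
  exists (H : int -> nat) (P : {poly rat}),
    [/\ is_hilbert_function I H, is_hilbert_polynomial H P,
        agree_from H P r &
        forall r' : int, agree_from H P r' -> r <= r'].

(** * Minimal graded free resolutions, Betti numbers, regularity *)

(* Data of a sequence
     ... -> F_2 -> F_1 -> F_0 -> S/I,  F_i = \bigoplus_(t < fr_rank i) S(-fr_deg t).
   Elements of F_i are row vectors, maps act by right multiplication, and the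
   map F_0 -> S/I is given by representatives in S of the images of the basis
   elements.  Shifts are taken in nat: S/I being generated in degree 0, all
   the shifts of its minimal resolution are nonnegative. *)
Record free_complex (k : fieldType) (n : nat) := FreeComplex {
  fr_rank : nat -> nat;
  fr_deg : forall i, 'I_(fr_rank i) -> nat;
  fr_diff : forall i, 'M[{mpoly k[n]}]_(fr_rank i.+1, fr_rank i);
  fr_aug : 'cV[{mpoly k[n]}]_(fr_rank 0)
}.

(* All the maps are homogeneous of degree 0. *)
Definition is_graded (k : fieldType) (n : nat) (F : free_complex k n) : Prop :=
  (forall t, fr_aug F t 0 \is (fr_deg t).-homog) /\
  (forall i (t : 'I_(fr_rank F i.+1)) (u : 'I_(fr_rank F i)),
     fr_diff F i t u != 0 ->
     exists2 e, fr_deg t = (e + fr_deg u)%N & fr_diff F i t u \is e.-homog).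

(* ... -> F_1 -> F_0 -> S/I -> 0 is exact. *)
Definition is_resolution (k : fieldType) (n : nat) (I : pred {mpoly k[n]})
    (F : free_complex k n) : Prop :=
  [/\ forall p, exists v : 'rV_(fr_rank F 0), I (p - (v *m fr_aug F) 0 0),
      forall v : 'rV_(fr_rank F 0),
        I ((v *m fr_aug F) 0 0) <-> exists w, v = w *m fr_diff F 0 &
      forall i (v : 'rV_(fr_rank F i.+1)),
        v *m fr_diff F i = 0 <-> exists w, v = w *m fr_diff F i.+1].

(* The image of F_(i+1) is contained in (x_0, ..., x_(n-1)) F_i. *)
Definition is_minimal (k : fieldType) (n : nat) (F : free_complex k n) : Prop :=
  forall i t u, (fr_diff F i t u)@_0%MM = 0.

Definition is_minimal_graded_free_resolution (k : fieldType) (n : nat)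
    (I : pred {mpoly k[n]}) (F : free_complex k n) : Prop :=
  [/\ is_graded F, is_resolution I F & is_minimal F].

Definition are_graded_betti_numbers (k : fieldType) (n : nat)
    (I : pred {mpoly k[n]}) (beta : nat -> nat -> nat) : Prop :=
  exists2 F : free_complex k n,
    is_minimal_graded_free_resolution I F &
    forall i j, beta i j = #|[set t : 'I_(fr_rank F i) | fr_deg t == j]|.

Definition is_castelnuovo_mumford_regularity (k : fieldType) (n : nat)
    (I : pred {mpoly k[n]}) (reg : int) : Prop :=
  exists beta : nat -> nat -> nat,
    [/\ are_graded_betti_numbers I beta,
        exists i j, beta i j != 0%N /\ reg = j%:Z - i%:Z &
        forall i j, beta i j != 0%N -> j%:Z - i%:Z <= reg].

(* Main.v *)
From HB Require Import structures.
Require Import Defs.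
From mathcomp Require Import all_boot all_order all_algebra.
From mathcomp Require Import mpoly.
From mathcomp Require Import zify ring.

(** Write [R] for the coordinate ring, [y] and [z] for the variables attached to
    [0] and to [d], so that [y] maps to [v^d] and [z] to [u^d], and let [sA] be
    the [s]-fold sumset. The degree [s] part of [R] has the monomials
    [u^x v^(sd-x)], [x] in [sA], as a basis. Hence statements about [R] in
    degree [s] are statements about [sA]:

    - reduction: [R_(j+1) = y R_j + z R_j] says that every [x] in [(j+1)A] lies
      in [jA] or in [d + jA];
    - injectivity: [z] is injective on [(R/yR)_(s+1)] says that [x] lies in [sA]
      as soon as [x] and [d + x] lie in [(s+1)A].

    The core of the proof is that [m] bounds the regularity if and only if
    reduction holds for all [j >= m] and injectivity for all [s >= m].
    Regularity being defined by a minimal free resolution [F], this is done by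
    setting the variables to zero one at a time in [F]. Let [F/V] be [F] with
    the variables in [V] set to zero, and say that [F/V] is good if
    [H_i (F/V)_j = 0] for all [j > m + i].

    - If [V] consists of all variables, the differential of [F/V] vanishes by
      minimality, and [F/V] is good if and only if the generators of each [F_i]
      have degree at most [m + i] ([exact_of_degree_le], [degree_le_of_exact]).
    - The long exact sequence of multiplication by a variable [x] shows that if
      [F/V] is good, so is [F/(x,V)] ([exact_up]). Conversely, if [F/(x,V)] is
      good then [x] is injective on [H_i (F/V)_j] for [j > m + i], so that
      [F/V] is good as soon as [x] acts nilpotently on its homology
      ([boundary_divXn]). This is the case if [V] contains [y] and [z]: with [a]
      the integer attached to [x], one has [x^d = y^(d-a) z^a] in [R]
      ([nilpotent_ZY]).
    - For [V = {y, z}] the homology can be read off from [R]: it vanishes in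
      homological degrees at least [2], [H_0] is [R/(y,z)R] and [H_1] is the
      kernel of [z] on [R/yR] ([exact_ZY_0_of_reduction],
      [exact_ZY_1_of_injective], [sums_reduction_of_exact],
      [sums_injective_of_exact]).

    The theorem is now a matter of sumsets. For [s >= sigma] the decomposition
    of [sA] says that [x] lies in [sA] if and only if [x] lies in the first
    semigroup and [sd - x] in the second one; with [c1 + c2 <= sigma d] this
    gives reduction for [j > sigma] and injectivity for [s >= sigma], so the
    regularity is at most [sigma + 1] ([decomposition_reduction],
    [decomposition_injective]). Let now [m] be the regularity. Reduction and
    injectivity make translation by [d] a bijection from [(s+1)A \ sA] to
    [(s+2)A \ (s+1)A] for [s >= m], so the Hilbert function is affine from [m]
    on and its regularity is at most [m] ([hilbert_regularity_le_of_sums]);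
    this is the lower bound in (1). For the lower bound in (2), the number
    [c1 - 1 + d] is in the first semigroup, but [c1 - 1] is not: repeated
    reduction puts it in [mA], as a sum of [m] elements all smaller than [d].
    Hence [c1 - 1 + d <= m (d - 1)] ([conductor_le_of_reduction]), and likewise
    for [c2]; adding up, [c1 + c2 <= 2 (m - 1) (d - 1)], so the ceiling of
    [(c1 + c2) / d] is at most [2 (m - 1)]. *)

Set Implicit Arguments.
Unset Strict Implicit.
Unset Printing Implicit Defensive.

Import Order.TTheory GRing.Theory Num.Theory.

Local Open Scope nat_scope.

(** * Sumsets *)

Definition sums (A : seq nat) (s : nat) : seq nat :=
  iter s (fun B => undup [seq a + b | a <- A, b <- B]) [:: 0].

Lemma sums_uniq A s : uniq (sums A s).
Proof. by case: s => [//|s]; rewrite /sums iterS undup_uniq. Qed.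

Lemma sums0E A x : (x \in sums A 0) = (x == 0).
Proof. by rewrite inE. Qed.

Lemma sumsSP A s x :
  reflect (exists a b, [/\ a \in A, b \in sums A s & x = a + b])
          (x \in sums A s.+1).
Proof.
rewrite /sums iterS mem_undup -/(sums A s).
apply: (iffP allpairsP) => [[[a b] /= [*]]|[a [b [*]]]]; first by exists a, b.
by exists (a, b).
Qed.

Lemma sums_add A s a x : a \in A -> x \in sums A s -> a + x \in sums A s.+1.
Proof. by move=> aA xs; apply/sumsSP; exists a, x. Qed.

Lemma sumsP A s x : reflect (sumset A s x) (x \in sums A s).
Proof.
apply: (iffP idP).
  elim: s x => [x|s IH x]; first by rewrite sums0E => /eqP->; exists [tuple].
  case/sumsSP=> a [b [aA /IH[t tA ->] ->]].
  by exists [tuple of a :: t] => //=; rewrite aA.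
elim: s x => [x|s IH x] [t].
  by rewrite (tuple0 t) => _ ->; rewrite sums0E.
case/tupleP: t => a t /= /andP[aA tA] ->.
by apply: sums_add => //; apply: IH; exists t.
Qed.

Lemma sums_mono A s t : 0 \in A -> s <= t -> {subset sums A s <= sums A t}.
Proof.
move=> A0; elim: t => [|t IH]; first by rewrite leqn0 => /eqP->.
rewrite leq_eqVlt => /orP[/eqP-> //|st] x xs.
by rewrite -[x]add0n; apply: sums_add => //; apply: IH.
Qed.

Lemma sumsD A s t x y :
  x \in sums A s -> y \in sums A t -> x + y \in sums A (s + t).
Proof.
elim: s x => [x|s IH x]; first by rewrite sums0E => /eqP->.
case/sumsSP=> a [b [aA bs ->]] yt.
by rewrite -addnA addSn; apply: sums_add => //; apply: IH.
Qed.

Lemma sums_gen A s x : uniq A -> x \in sums A s -> generated_semigroup A x.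
Proof.
move=> uA; elim: s x => [x|s IH x].
  rewrite sums0E => /eqP->; exists (fun=> 0).
  by rewrite big1 // => i _; rewrite mul0n.
case/sumsSP=> a [b [aA /IH[c ->] ->]].
exists (fun i => (i == a) + c i).
under [RHS]eq_bigr do rewrite mulnDl.
rewrite big_split /=; congr (_ + _).
rewrite (bigD1_seq a) //= eqxx mul1n big1 ?addn0 // => i /negPf->.
by rewrite mul0n.
Qed.

Lemma gen_sums A x : generated_semigroup A x -> exists s, x \in sums A s.
Proof.
case=> c ->; rewrite big_seq.
elim/big_ind: _ => [|x1 x2 [s1 h1] [s2 h2]|a aA].
- by exists 0.
- by exists (s1 + s2); apply: sumsD.
exists (c a); elim: (c a) => [//|j IH].
by rewrite mulSn; apply: sums_add.
Qed.

Lemma gen_add A a x : uniq A -> a \in A -> generated_semigroup A x ->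
  generated_semigroup A (a + x).
Proof.
move=> uA aA /gen_sums[s xs]; apply: (@sums_gen _ s.+1) => //.
exact: sums_add.
Qed.

Section Reflection.
Variables (d : nat) (A : seq nat).
Hypothesis leAd : {in A, forall a, a <= d}.

Lemma reflected_le : {in reflected d A, forall a, a <= d}.
Proof. by move=> _ /mapP[a _ ->]; apply: leq_subr. Qed.

Lemma reflectedK : reflected d (reflected d A) = A.
Proof.
rewrite /reflected -map_comp -[RHS]map_id.
by apply/eq_in_map => a aA /=; rewrite subKn ?leAd.
Qed.

Lemma reflected_uniq : uniq A -> uniq (reflected d A).
Proof.
move=> uA; rewrite map_inj_in_uniq // => a b /leAd ad /leAd bd /=; lia.
Qed.

Lemma sums_le s x : x \in sums A s -> x <= s * d.
Proof.
elim: s x => [x|s IH x]; first by rewrite sums0E => /eqP->.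
by case/sumsSP=> a [b [/leAd aA /IH bs ->]]; rewrite mulSn leq_add.
Qed.

Lemma sums_reflect s x :
  x \in sums A s -> s * d - x \in sums (reflected d A) s.
Proof.
elim: s x => [x|s IH x]; first by rewrite sums0E => /eqP->.
case/sumsSP=> a [b [aA bs ->]].
have := sums_le bs; have := leAd aA => ad bsd.
have -> : s.+1 * d - (a + b) = (d - a) + (s * d - b) by lia.
by apply: sums_add; [apply: map_f | apply: IH].
Qed.

End Reflection.

(** * Consequences of the sumset decomposition *)

(** The integer [c - 1] is not in [S]: this is why the initial parts stop at
    [c - 2]. *)
Lemma conductor_pred (S : nat -> Prop) c x :
  is_conductor S c -> S x -> x < c -> x + 2 <= c.
Proof.
move=> [Sc minc] Sx xc; rewrite leqNgt; apply/negP => cx.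
suff : c <= x by lia.
apply: minc => m; rewrite leq_eqVlt => /orP[/eqP<- //|xm]; apply: Sc; lia.
Qed.

Section Decomposition.
Variables (A : seq nat) (d c1 c2 sigma : nat).
Hypothesis uA : uniq A.
Hypothesis leAd : {in A, forall a, a <= d}.
Hypothesis hc1 : is_conductor (generated_semigroup A) c1.
Hypothesis hc2 : is_conductor (generated_semigroup (reflected d A)) c2.
Hypothesis hdec : forall s, sigma <= s -> sumset_decomposition A d c1 c2 s.

Local Notation S1 := (generated_semigroup A).
Local Notation S2 := (generated_semigroup (reflected d A)).

(** The decomposition amounts to the description of [sA], for [s >= sigma], by
    the two semigroups alone; this is the inclusion that fails for small [s]. *)
Lemma decomposition_sums s x y : sigma <= s -> S1 x -> S2 y -> x + y = s * d ->
  x \in sums A s.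
Proof.
move=> ss Sx Sy xy; apply/sumsP.
have [_ dec _ _ _] := hdec ss; apply/dec.
have [xc|xc] := ltnP x c1.
  by apply: Or31; split => //; apply: conductor_pred hc1 Sx xc.
have [yc|yc] := ltnP y c2; last by apply: Or32; apply/andP; split=> //; lia.
apply: Or33; exists y => //; split => //.
by apply: conductor_pred hc2 Sy yc.
Qed.

Lemma decomposition_bound s : sigma <= s -> c1 + c2 <= s * d.
Proof. by move=> ss; have [] := hdec ss. Qed.

Lemma sums_S1 s x : x \in sums A s -> S1 x.
Proof. exact: sums_gen. Qed.

Lemma sums_S2 s x : x \in sums A s -> S2 (s * d - x).
Proof.
by move=> /(sums_reflect leAd)/sums_gen; apply; apply: reflected_uniq.
Qed.

(** If [x >= c1 + d], then [d] can be subtracted on the side of the first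
    semigroup. Otherwise [(j + 1) d - x] is at least [c2 + d], because
    [c1 + c2 <= (j - 1) d], and [d] can be subtracted on the side of the second
    one. *)
Lemma decomposition_reduction j x : sigma < j -> x \in sums A j.+1 ->
  x \in sums A j \/ (d <= x /\ x - d \in sums A j).
Proof.
move=> sj xj; have xS := sums_S1 xj; have yS := sums_S2 xj.
have xle := sums_le leAd xj.
have := decomposition_bound (_ : sigma <= j.-1).
rewrite -ltnS prednK; last by lia.
move=> /(_ sj) cb.
have jd : j * d = d + j.-1 * d by rewrite -mulSn prednK //; lia.
rewrite mulSn in yS xle.
have [xc|xc] := leqP (c1 + d) x.
  right; split; first by lia.
  apply: decomposition_sums yS _; [lia| |lia].
  by apply: (proj1 hc1); lia.
left; apply: (@decomposition_sums j x (j * d - x)); [lia|by []| |lia].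
by apply: (proj1 hc2); lia.
Qed.

(** Membership of [d + x] in [sA] puts [sd - (d + x) = (s - 1) d - x] in the
    second semigroup, and [x] is in the first one. *)
Lemma decomposition_injective s x :
  sigma < s -> x \in sums A s -> d + x \in sums A s -> x \in sums A s.-1.
Proof.
move=> ss xs dxs; have := sums_le leAd dxs.
have jd : s * d = d + s.-1 * d by rewrite -mulSn prednK //; lia.
move=> le; apply: decomposition_sums (sums_S1 xs) (sums_S2 dxs) _; lia.
Qed.

End Decomposition.

(** * Bounds on the conductors *)

(** If [x - d] is not in the semigroup, no way of writing [x] as a sum of [m]
    elements of [A] can use [d], so each summand is at most [d - 1]. *)
Lemma sums_le_of_apery A d m x : uniq A -> {in A, forall a, a <= d} ->
  d \in A -> x \in sums A m ->
  (d <= x -> ~ generated_semigroup A (x - d)) ->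
  x <= m * d.-1.
Proof.
move=> uA leAd dA; elim: m x => [x|m IH x]; first by rewrite sums0E => /eqP->.
case/sumsSP=> a [b [aA bs ->]] nod.
have ad : a <= d.-1.
  have := leAd _ aA; suff: a <> d by lia.
  move=> e; case: nod; first by lia.
  by rewrite e addKn; apply: sums_gen bs.
suff : b <= m * d.-1 by rewrite mulSn; lia.
apply: IH => // db Sb; apply: nod; first by lia.
rewrite -addnBA //; exact: gen_add.
Qed.

(** Apply [sums_le_of_apery] to [x = c - 1 + d]. This [x] is in the semigroup,
    hence in some sumset, and since [x - d] is not in the semigroup the second
    alternative of the reduction never occurs: [x] descends to the [m]-fold
    sumset. *)
Lemma conductor_le_of_reduction A d m c :
  uniq A -> {in A, forall a, a <= d} -> 0 \in A -> d \in A -> 0 < d ->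
  is_conductor (generated_semigroup A) c ->
  (forall j x, m <= j -> x \in sums A j.+1 ->
     x \in sums A j \/ (d <= x /\ x - d \in sums A j)) ->
  c + d <= m * d.-1 + 1.
Proof.
move=> uA leAd A0 dA d0 [Sc minc] red.
pose x := (c + d).-1.
have nod : d <= x -> ~ generated_semigroup A (x - d).
  move=> dx Sx; suff : c <= c.-1 by lia.
  apply: minc => y cy; have [|yc] := leqP c y; first exact: Sc.
  by have <- : x - d = y by lia.
suff xm : x \in sums A m by have := sums_le_of_apery uA leAd dA xm nod; lia.
have /gen_sums[s xs] : generated_semigroup A x by apply: Sc; lia.
have : x \in sums A (m + s) by apply: sums_mono xs => //; lia.
elim: s {xs} => [|s IH]; first by rewrite addn0.
rewrite addnS => /red [|//|[dx xds]]; first by lia.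
by case: (nod dx); apply: sums_gen xds.
Qed.

(** The reflection [x |-> (j + 1) d - x] exchanges the two alternatives. *)
Lemma reflected_reduction A d m :
  {in A, forall a, a <= d} ->
  (forall j x, m <= j -> x \in sums A j.+1 ->
     x \in sums A j \/ (d <= x /\ x - d \in sums A j)) ->
  forall j x, m <= j -> x \in sums (reflected d A) j.+1 ->
     x \in sums (reflected d A) j \/
     (d <= x /\ x - d \in sums (reflected d A) j).
Proof.
move=> leAd red j x mj xj.
have leRd := @reflected_le d A.
have xle := sums_le leRd xj.
have := sums_reflect leRd xj; rewrite (reflectedK leAd) => /(red _ _ mj).
rewrite mulSn in xle *.
case=> [h|[le h]]; have hle := sums_le leAd h; have := sums_reflect leAd h.
  by right; split; [lia|have -> : x - d = j * d - (d + j * d - x) by lia].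
by left; have -> : x = j * d - (d + j * d - x - d) by lia.
Qed.

(** * Growth of the sumsets *)

(** Under the two hypotheses, translation by [d] is a bijection between the new
    elements of two consecutive sumsets, so that the first differences of the
    cardinal agree. *)
Lemma size_sums_rec A d s :
  0 \in A -> d \in A ->
  (forall x, x \in sums A s.+2 ->
     x \in sums A s.+1 \/ (d <= x /\ x - d \in sums A s.+1)) ->
  (forall x, x \in sums A s.+1 -> (d + x) \in sums A s.+1 ->
     x \in sums A s) ->
  (size (sums A s.+2) + size (sums A s) = size (sums A s.+1) * 2).
Proof.
move=> a0 ad red inj.
pose new t := [seq x <- sums A t.+1 | x \notin sums A t].
have sizeE t : size (sums A t.+1) = (size (sums A t) + size (new t)).
  rewrite /new [X in (_ + X)]size_filter -(count_predC (mem (sums A t))).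
  congr addn; rewrite -size_filter; apply: perm_size; apply: uniq_perm.
  - by rewrite filter_uniq // sums_uniq.
  - exact: sums_uniq.
  move=> x; rewrite mem_filter /=; case: (boolP (x \in sums A t)) => //= xt.
  exact: (sums_mono a0 (leqnSn t) xt).
suff -> : size (sums A s.+2) = (size (sums A s.+1) + size (new s)).
  by rewrite [size (sums A s.+1)]sizeE; lia.
rewrite sizeE; congr addn.
rewrite -(size_map (addn d) (new s)); apply: perm_size; apply: uniq_perm.
- by rewrite filter_uniq // sums_uniq.
- by rewrite map_inj_uniq ?filter_uniq ?sums_uniq //; apply: addnI.
move=> x; rewrite mem_filter; apply/andP/mapP => [[xs xS]|[y]].
  case: (red x xS) => [|[dx xd]]; first by rewrite (negPf xs).
  exists (x - d); last by rewrite subnKC.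
  rewrite mem_filter xd andbT; apply: contra xs => xds.
  by rewrite -(subnKC dx); apply: sums_add.
rewrite mem_filter => /andP[ys yS] ->; split; last exact: sums_add.
by apply: contra ys; apply: inj.
Qed.

Local Open Scope ring_scope.

(** * The toric ideal *)

Section Toric.
Variables (k : fieldType) (n d : nat) (a : n.-tuple nat).
Hypothesis d_gt0 : (0 < d)%N.
Hypothesis leAd : forall i, (tnth a i <= d)%N.

Local Notation I := (toric_ideal k a d).

Definition mweight (m : 'X_{1..n}) : nat := (\sum_i m i * tnth a i)%N.

(** The parametrization of the curve up to a change of coordinates: the outer
    variable records the degree, the inner one the exponent of [u]. The exponent
    of [v] is determined by these two. *)
Definition bigraded (p : {mpoly k[n]}) : {poly {poly k}} :=
  mmap (polyC \o polyC) (fun i => ('X^(tnth a i))%:P * 'X) p.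

(** The coordinate of the class of [p] on the basis monomial [u^x v^(sd-x)] of
    the coordinate ring. *)
Definition bicoef (s x : nat) (p : {mpoly k[n]}) : k := (bigraded p)`_s`_x.

Lemma mweight0 : mweight 0 = 0%N.
Proof. by rewrite /mweight big1 // => i _; rewrite mnm0E. Qed.

Lemma mweightD m1 m2 : mweight (m1 + m2) = (mweight m1 + mweight m2)%N.
Proof.
by rewrite -big_split; apply: eq_bigr => i _; rewrite mnmDE mulnDl.
Qed.

Lemma mweightMn m N : mweight (m *+ N) = (N * mweight m)%N.
Proof.
elim: N => [|N IH]; first by rewrite mulm0n mweight0.
by rewrite mulmS mweightD IH mulSn.
Qed.

Lemma mweightU i : mweight U_(i) = tnth a i.
Proof.
rewrite /mweight (bigD1 i) //= mnm1E eqxx mul1n big1 ?addn0 // => j ji.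
by rewrite mnm1E eq_sym (negPf ji).
Qed.

Lemma mweight_sums m : mweight m \in sums a (mdeg m).
Proof.
rewrite /mweight mdegE; elim/big_ind2: _ => //.
  by move=> x1 x2 y1 y2; apply: sumsD.
move=> i _; elim: (m i) => [//|j IH].
by rewrite mulSn; apply: sums_add => //; apply: mem_tnth.
Qed.

Lemma sums_mnm s x :
  x \in sums a s -> exists2 m : 'X_{1..n}, mdeg m = s & mweight m = x.
Proof.
elim: s x => [x|s IH x].
  by rewrite sums0E => /eqP->; exists 0%MM; rewrite ?mdeg0 ?mweight0.
case/sumsSP=> b [y [/tnthP[i ->] /IH[m <- <-] ->]].
by exists (U_(i) + m)%MM; rewrite ?mdegD ?mdeg1 ?mweightD ?mweightU.
Qed.

Lemma mweight_le m : (mweight m <= mdeg m * d)%N.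
Proof.
apply: (sums_le (A := a)); last exact: mweight_sums.
by move=> _ /tnthP[i ->].
Qed.

(** A chosen monomial of degree [s] and weight [x]; the default value is used
    only when [x] is not in the [s]-fold sumset. *)
Definition mon (s x : nat) : 'X_{1..n} :=
  if [pick m : 'X_{1..n < s.+1} | (mdeg m == s) && (mweight m == x)] is Some m
  then m : 'X_{1..n} else 0%MM.

Lemma monP s x : x \in sums a s -> mdeg (mon s x) = s /\ mweight (mon s x) = x.
Proof.
case/sums_mnm => m ms mx; rewrite /mon; case: pickP => [b|].
  by case/andP=> /eqP -> /eqP ->.
have mlt : (mdeg m < s.+1)%N by rewrite ms.
by move=> /(_ (BMultinom mlt)) /=; rewrite ms mx !eqxx.
Qed.

Lemma bigradedX m : bigraded 'X_[m] = ('X^(mweight m))%:P * 'X^(mdeg m).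
Proof.
rewrite /bigraded mmapX /mmap1 /mweight mdegE.
rewrite (eq_bigr (fun i => ('X^(m i * tnth a i))%:P * 'X^(m i))); last first.
  by move=> i _; rewrite exprMn -polyC_exp -exprM mulnC.
rewrite big_split /=; congr (_ * _).
  by rewrite -rmorph_prod /= expr_sum.
by rewrite expr_sum.
Qed.

Lemma bigradedM p q : bigraded (p * q) = bigraded p * bigraded q.
Proof. exact: rmorphM. Qed.

Lemma bicoefD s x p q : bicoef s x (p + q) = bicoef s x p + bicoef s x q.
Proof. by rewrite /bicoef /bigraded raddfD !coefD. Qed.

Lemma bicoefN s x p : bicoef s x (- p) = - bicoef s x p.
Proof. by rewrite /bicoef /bigraded raddfN !coefN. Qed.

Lemma bicoefB s x p q : bicoef s x (p - q) = bicoef s x p - bicoef s x q.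
Proof. by rewrite bicoefD bicoefN. Qed.

Lemma bicoefZ s x c p : bicoef s x (c *: p) = c * bicoef s x p.
Proof. by rewrite /bicoef /bigraded mmapZ /= !coefCM. Qed.

Lemma bicoef0 s x : bicoef s x 0 = 0.
Proof. by rewrite /bicoef /bigraded raddf0 !coef0. Qed.

Lemma bicoef_sum s x (J : Type) (r : seq J) (P : pred J)
    (F : J -> {mpoly k[n]}) :
  bicoef s x (\sum_(j <- r | P j) F j) = \sum_(j <- r | P j) bicoef s x (F j).
Proof. exact: (big_morph _ (bicoefD s x) (bicoef0 s x)). Qed.

Lemma bicoefX s x m :
  bicoef s x 'X_[m] = ((mdeg m == s) && (mweight m == x))%:R.
Proof.
rewrite /bicoef bigradedX coefCM coefXn eq_sym.
by case: eqP => _; rewrite ?mulr1 ?mulr0 ?coef0 // coefXn eq_sym.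
Qed.

Lemma bicoef_mulX s x m q :
  bicoef s x ('X_[m] * q) =
  if (mdeg m <= s)%N && (mweight m <= x)%N
  then bicoef (s - mdeg m) (x - mweight m) q else 0.
Proof.
rewrite /bicoef bigradedM bigradedX -mulrA coefCM coefXnM.
case: (leqP (mweight m) x) => _; rewrite ?andbF //= andbT coefXnM.
by case: (leqP (mdeg m) s) => _; rewrite ?coef0.
Qed.

Lemma bicoefE s x p :
  bicoef s x p =
  \sum_(m <- msupp p) p@_m * ((mdeg m == s) && (mweight m == x))%:R.
Proof.
rewrite {1}[p]mpolyE bicoef_sum; apply: eq_bigr => m _.
by rewrite bicoefZ bicoefX.
Qed.

Lemma bicoef_neq0 s x p : bicoef s x p != 0 ->
  exists m, [/\ m \in msupp p, mdeg m = s & mweight m = x].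
Proof.
move=> nz.
have [/hasP[m mp /andP[/eqP ms /eqP mx]]|/hasPn no] :=
  boolP (has (fun m => (mdeg m == s) && (mweight m == x)) (msupp p)).
  by exists m.
case/eqP: nz; rewrite bicoefE big_seq big1 // => m /no /negPf->.
by rewrite mulr0.
Qed.

Lemma bicoef_sums s x p : bicoef s x p != 0 -> x \in sums a s.
Proof. by case/bicoef_neq0=> m [_ <- <-]; apply: mweight_sums. Qed.

Let c0 : 'I_2 := ord0.
Let c1 : 'I_2 := lift ord0 ord0.

Let curve_mon (s x : nat) : 'X_{1..2} :=
  (U_(c0) *+ x + U_(c1) *+ (s * d - x))%MM.

Lemma curve_mon_inj s x s' x' : (x <= s * d)%N -> (x' <= s' * d)%N ->
  (curve_mon s x == curve_mon s' x') = (s == s') && (x == x').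
Proof.
move=> xs xs'; apply/eqP/andP => [e|[/eqP-> /eqP->] //].
have := congr1 (fun m : 'X_{1..2} => m c0) e.
have := congr1 (fun m : 'X_{1..2} => m c1) e.
rewrite /curve_mon !mnmDE !mulmnE !mnm1E !eqxx /= !mul1n !mul0n !addn0 !add0n.
move=> e1 e0; rewrite e0 eqxx; split=> //.
by rewrite -(eqn_pmul2r d_gt0); apply/eqP; lia.
Qed.

Lemma comp_curveX m :
  'X_[m] \mPo curve_param k a d = 'X_[curve_mon (mdeg m) (mweight m)].
Proof.
rewrite comp_mpolyX /curve_mon mpolyXD -!mpolyXn.
under eq_bigr do rewrite tnth_mktuple exprMn -!exprM.
rewrite big_split /= -!expr_sum; congr (_ ^+ _ * _ ^+ _).
  by apply: eq_bigr => i _; rewrite mulnC.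
have -> : (mdeg m * d = \sum_i m i * (d - tnth a i) + mweight m)%N.
  rewrite /mweight mdegE big_distrl /= -big_split /=; apply: eq_bigr => i _.
  by rewrite -mulnDr subnK.
by rewrite addnK; apply/eq_bigr => i _; rewrite mulnC.
Qed.

Lemma comp_curve_coef p c :
  (p \mPo curve_param k a d)@_c =
  \sum_(m <- msupp p) p@_m * (curve_mon (mdeg m) (mweight m) == c)%:R.
Proof.
rewrite {1}[p]mpolyE.
rewrite (big_morph _ (comp_mpolyD _) (comp_mpoly0 _)) raddf_sum /=.
apply: eq_bigr => m _; by rewrite comp_mpolyZ mcoeffZ comp_curveX mcoeffX.
Qed.

(** The coefficients of the image of [p] in [k[u,v]] are the [bicoef s x p]:
    the monomials [u^x v^(sd-x)] with [x <= sd] are pairwise distinct as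
    [d > 0], and no other monomial occurs. *)
Lemma toricP p : I p <-> forall s x, bicoef s x p = 0.
Proof.
have key s x : (x <= s * d)%N ->
    (p \mPo curve_param k a d)@_(curve_mon s x) = bicoef s x p.
  move=> xs; rewrite comp_curve_coef bicoefE; apply: eq_bigr => m _.
  by rewrite curve_mon_inj // mweight_le.
split=> [/eqP p0 s x|p0].
  apply: contraTeq isT => nz; have [m [_ ms mx]] := bicoef_neq0 nz.
  by rewrite -key ?p0 ?mcoeff0 ?eqxx // -ms -mx ?mweight_le in nz.
apply/eqP/mpolyP => c; rewrite mcoeff0.
have [/hasP[m mp /eqP <-]|/hasPn no] :=
  boolP (has (fun m => curve_mon (mdeg m) (mweight m) == c) (msupp p)).
  by rewrite key ?p0 // mweight_le.
rewrite comp_curve_coef big_seq big1 // => m /no /negPf->.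
by rewrite mulr0.
Qed.

Lemma homog_toricP s p : p \is s.-homog ->
  (forall x, bicoef s x p = 0) -> I p.
Proof.
move=> /dhomogP hp p0; apply/toricP => s' x.
apply: contraTeq isT => nz; have [m [mp ms mx]] := bicoef_neq0 nz.
by move: nz; rewrite -ms (hp m mp) p0 eqxx.
Qed.

Lemma toricB p q : I p -> I q -> I (p - q).
Proof.
by move=> /eqP ip /eqP iq; apply/eqP; rewrite comp_mpolyB ip iq subr0.
Qed.

Lemma toricD p q : I p -> I q -> I (p + q).
Proof.
by move=> /eqP ip /eqP iq; apply/eqP; rewrite comp_mpolyD ip iq addr0.
Qed.

Lemma toricM p q : I p -> I (q * p).
Proof. by move=> /eqP ip; apply/eqP; rewrite rmorphM /= ip mulr0. Qed.

(** Monomials are nonzerodivisors modulo the toric ideal: multiplication by one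
    only shifts the indices of the coordinates. *)
Lemma toric_mulX_inv m p : I ('X_[m] * p) -> I p.
Proof.
move/toricP => p0; apply/toricP => s x.
have := p0 (mdeg m + s)%N (mweight m + x)%N.
by rewrite bicoef_mulX !leq_addr !addKn.
Qed.

Lemma toric_binom m m' : mdeg m = mdeg m' -> mweight m = mweight m' ->
  I ('X_[m] - 'X_[m']).
Proof.
by move=> e1 e2; apply/toricP => s x; rewrite bicoefB !bicoefX e1 e2 subrr.
Qed.

(** A form of degree [s] with prescribed coordinates. *)
Definition bicoef_lift (s : nat) (P : pred nat) (c : nat -> k) : {mpoly k[n]} :=
  \sum_(x <- sums a s | P x) c x *: 'X_[mon s x].

Lemma bicoef_lift_homog s P c : bicoef_lift s P c \is s.-homog.
Proof.
rewrite /bicoef_lift big_seq_cond; apply: rpred_sum => x /andP[xs _].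
by apply: rpredZ; rewrite dhomogX; apply/eqP; exact: (proj1 (monP xs)).
Qed.

Lemma bicoef_of_lift s P c x :
  bicoef s x (bicoef_lift s P c) = if (x \in sums a s) && P x then c x else 0.
Proof.
rewrite /bicoef_lift bicoef_sum big_seq_cond.
rewrite (eq_bigr (fun y => if y == x then c y else 0)); last first.
  move=> y /andP[/monP[e1 e2] _]; rewrite bicoefZ bicoefX e1 e2 eqxx /=.
  by case: eqP => _; rewrite ?mulr1 ?mulr0.
rewrite -big_seq_cond; case: ifP => [/andP[xs Px]|no].
  rewrite big_mkcond (bigD1_seq x) ?sums_uniq //= Px eqxx big1 ?addr0 //.
  by move=> y /negPf->; case: ifP.
rewrite big_seq_cond big1 // => y /andP[ys Py].
by case: eqP => // e; move: no; rewrite -e ys Py.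
Qed.

Variables (Y Z : 'I_n).
Hypothesis aY : tnth a Y = 0%N.
Hypothesis aZ : tnth a Z = d.

Lemma bicoef_mulY s x q : bicoef s.+1 x ('X_Y * q) = bicoef s x q.
Proof. by rewrite bicoef_mulX mdeg1 mweightU aY /= subn0 subSS subn0. Qed.

Lemma bicoef_mulZ s x q :
  bicoef s.+1 x ('X_Z * q) = if (d <= x)%N then bicoef s (x - d) q else 0.
Proof. by rewrite bicoef_mulX mdeg1 mweightU aZ /= subSS subn0. Qed.

Lemma homog_mulX s i (q : {mpoly k[n]}) :
  q \is s.-homog -> 'X_i * q \is s.+1.-homog.
Proof.
move=> hq; rewrite -add1n; apply: dhomogM => //.
by rewrite dhomogX; apply/eqP; exact: mdeg1.
Qed.

(** Divisibility by [y] modulo the toric ideal is tested on the support,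
    because [y] shifts the degree of a basis monomial without changing [x]. *)
Lemma toric_divY s p : p \is s.+1.-homog ->
  (forall x, bicoef s.+1 x p != 0 -> x \in sums a s) ->
  exists q, I (p - 'X_Y * q).
Proof.
move=> hp sup; pose q := bicoef_lift s predT (fun x => bicoef s.+1 x p).
have hq : q \is s.-homog by apply: bicoef_lift_homog.
exists q; apply: (homog_toricP (s := s.+1)) => [|x].
  by apply: rpredB => //; apply: homog_mulX.
rewrite bicoefB bicoef_mulY bicoef_of_lift andbT.
case: ifPn => [_|xs]; first by rewrite subrr.
by rewrite subr0; apply: contraNeq xs; apply: sup.
Qed.

(** A basis monomial is divided by [y] whenever possible, and by [z]
    otherwise. *)
Lemma toric_divYZ s p : p \is s.+1.-homog ->
  (forall x, x \in sums a s.+1 ->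
     x \in sums a s \/ (d <= x /\ x - d \in sums a s)%N) ->
  exists q1 q2, I (p - ('X_Y * q1 + 'X_Z * q2)).
Proof.
move=> hp red; pose q1 := bicoef_lift s predT (fun x => bicoef s.+1 x p).
pose q2 := bicoef_lift s (fun x => (d + x)%N \notin sums a s)
  (fun x => bicoef s.+1 (d + x)%N p).
have hq1 : q1 \is s.-homog by apply: bicoef_lift_homog.
have hq2 : q2 \is s.-homog by apply: bicoef_lift_homog.
exists q1, q2; apply: (homog_toricP (s := s.+1)) => [|x].
  by apply: rpredB => //; apply: rpredD; apply: homog_mulX.
rewrite bicoefB bicoefD bicoef_mulY bicoef_mulZ !bicoef_of_lift andbT.
case: (leqP d x) => [dx|xd]; last first.
  rewrite addr0; case: ifPn => [_|xs]; first by rewrite subrr.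
  rewrite subr0; apply: contraNeq xs => /bicoef_sums /red [//|[]].
  by rewrite leqNgt xd.
rewrite subnKC //; case: ifPn => [xs|xs] /=; first by rewrite andbF addr0 subrr.
rewrite andbT add0r; case: ifPn => [_|xds]; first by rewrite subrr.
rewrite subr0; apply: contraNeq xds => /bicoef_sums /red [|[] //].
by rewrite (negPf xs).
Qed.

End Toric.

(** * Setting variables to zero *)

Section Kill.
Variables (k : fieldType) (n : nat).
Local Notation S := {mpoly k[n]}.
Implicit Types (V : seq 'I_n) (p q : S) (P : pred nat).

Definition kill V : S -> S :=
  comp_mpoly [tuple if i \in V then 0 else 'X_i | i < n].

HB.instance Definition _ V := GRing.RMorphism.copy (kill V)
  (comp_mpoly [tuple if i \in V then 0 else 'X_i | i < n]).

Definition avoids V (m : 'X_{1..n}) := all (fun i => m i == 0%N) V.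

Lemma killX V m : kill V 'X_[m] = if avoids V m then 'X_[m] else 0.
Proof.
rewrite /kill comp_mpolyX; case: ifPn => [/allP av|/allPn[i iV mi]].
  rewrite mpolyXE_id; apply: eq_bigr => i _; rewrite tnth_mktuple.
  by case: ifP => // /av /eqP->; rewrite !expr0.
by rewrite (bigD1 i) //= tnth_mktuple iV expr0n (negPf mi) mul0r.
Qed.

Lemma kill_coef V p m : (kill V p)@_m = if avoids V m then p@_m else 0.
Proof.
have killD : {morph kill V : p q / p + q} by move=> p' q'; apply: comp_mpolyD.
rewrite [p in LHS]mpolyE [p in RHS]mpolyE.
rewrite (big_morph (kill V) killD (rmorph0 _)) !raddf_sum /=.
rewrite (eq_bigr (fun m' => if avoids V m then (p@_m' *: 'X_[m'])@_m else 0)).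
  by case: ifP => // _; rewrite big1.
move=> m' _; rewrite /kill comp_mpolyZ -/(kill V _) killX !mcoeffZ mcoeffX.
case: (m' =P m) => [->|/eqP ne].
  by case: ifP => _; rewrite ?mcoeffX ?eqxx ?mulr1 ?mcoeff0 ?mulr0.
by case: ifP => _; rewrite ?mcoeffX ?(negPf ne) ?mcoeff0 ?mulr0 ?if_same.
Qed.

Lemma kill_nil p : kill [::] p = p.
Proof. by apply/mpolyP => m; rewrite kill_coef /=. Qed.

Lemma kill_id V p : kill V (kill V p) = kill V p.
Proof. by apply/mpolyP => m; rewrite !kill_coef; case: (avoids V m). Qed.

Lemma kill_cons z V p : kill (z :: V) (kill V p) = kill (z :: V) p.
Proof.
apply/mpolyP => m; rewrite !kill_coef /=.
by case: (avoids V m); rewrite ?andbF.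
Qed.

Lemma kill_var V z : kill V 'X_z = if z \in V then 0 else 'X_z.
Proof. by rewrite /kill comp_mpolyXU -tnth_nth tnth_mktuple. Qed.

(** Together with [kill_all], this is what detects a basis vector at the end of
    the process, when every variable is set to zero. *)
Lemma kill_constcoef V p : (kill V p)@_0 = p@_0.
Proof.
by rewrite kill_coef; case: ifP => // /negP[]; apply/allP => i _; rewrite mnm0E.
Qed.

Lemma kill_all V p : (forall i, i \in V) -> p@_0 = 0 -> kill V p = 0.
Proof.
move=> allV p0; apply/mpolyP => m; rewrite kill_coef mcoeff0.
case: ifP => // /allP av; rewrite -p0; congr (_@__).
by apply/mnmP => i; rewrite mnm0E; apply/eqP/av.
Qed.

Lemma mulX_div z p : (forall m, m \in msupp p -> (0 < m z)%N) ->
  exists q, p = 'X_z * q.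
Proof.
move=> pz; exists (\sum_(m <- msupp p) p@_m *: 'X_[m - U_(z)]).
rewrite {1}[p]mpolyE mulr_sumr !big_seq; apply: eq_bigr => m /pz mz.
rewrite -scalerAr -mpolyXD; congr (_ *: 'X_[_]).
rewrite addmC submK //; apply/mnm_lepP => i.
by rewrite mnm1E; case: eqP => // <-.
Qed.

Lemma kill_cons_div z V p : kill (z :: V) p = 0 ->
  exists q, kill V p = 'X_z * q.
Proof.
move=> p0; apply: mulX_div => m; rewrite mcoeff_msupp lt0n.
apply: contra => mz; have := congr1 (mcoeff m) p0.
by rewrite !kill_coef mcoeff0 /= mz /= => ->.
Qed.

(** With [P] the predicate of being equal to [j], this says that [p] is
    homogeneous of degree [j] in the free module generated in degree [e], with no
    subtraction [j - e]. A general [P] lets the same lemmas apply to the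
    complementary components of a polynomial. *)
Definition degs P (e : nat) p := forall m, m \in msupp p -> P (mdeg m + e)%N.

Lemma degsP P e p :
  degs P e p <-> forall m, p@_m != 0 -> P (mdeg m + e)%N.
Proof. by split=> h m; have := h m; rewrite mcoeff_msupp. Qed.

Lemma degs0 P e : degs P e 0.
Proof. by move=> m; rewrite msupp0. Qed.

Lemma degsD P e p q : degs P e p -> degs P e q -> degs P e (p + q).
Proof.
move=> hp hq m /msuppD_le; rewrite mem_cat => /orP[/hp|/hq] //.
Qed.

Lemma degsN P e p : degs P e p -> degs P e (- p).
Proof. by move=> hp m; rewrite (perm_mem (msuppN p)); apply: hp. Qed.

Lemma degs_sum P e (J : Type) (r : seq J) (Q : pred J) (G : J -> S) :
  (forall j, Q j -> degs P e (G j)) -> degs P e (\sum_(j <- r | Q j) G j).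
Proof.
by move=> h; elim/big_ind: _ => //; [apply: degs0|move=> *; apply: degsD].
Qed.

Lemma degs_mulr P e f p q :
  degs P (f + e) p -> q \is f.-homog -> degs P e (p * q).
Proof.
move=> hp /dhomogP hq m /msuppM_le /allpairsP[[m1 m2] /= [/hp h1 /hq h2 ->]].
by rewrite mdegD -addnA (h2 : mdeg m2 = f).
Qed.

Lemma degs_kill P e V p : degs P e p -> degs P e (kill V p).
Proof.
move=> /degsP hp; apply/degsP => m; rewrite kill_coef.
by case: ifP => _; [apply: hp | rewrite eqxx].
Qed.

Lemma degs_mulX P e z p :
  degs (fun j => P j.+1) e p <-> degs P e ('X_z * p).
Proof.
split=> h m.
  rewrite mulrC => /msuppM_le /allpairsP[[m1 m2] /= [/h h1]].
  rewrite msuppX inE => /eqP-> ->.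
  by rewrite mdegD mdeg1 addn1 addSn.
move=> mp; have := h (m + U_(z))%MM.
rewrite mdegD mdeg1 addn1 addSn; apply.
by rewrite mcoeff_msupp mulrC addmC mcoeffMX -mcoeff_msupp.
Qed.

Lemma degs_compl P e p : degs P e p -> degs (predC P) e p -> p = 0.
Proof.
move=> h1 h2; apply/mpolyP => m; rewrite mcoeff0; apply/eqP.
apply/negPn/negP; rewrite -mcoeff_msupp => mp.
by have := h2 m mp; rewrite /= (h1 m mp).
Qed.

Lemma degs_split P e p :
  exists p1 p2, [/\ degs P e p1, degs (predC P) e p2 & p = p1 + p2].
Proof.
exists (\sum_(m <- msupp p | P (mdeg m + e)%N) p@_m *: 'X_[m]).
exists (\sum_(m <- msupp p | ~~ P (mdeg m + e)%N) p@_m *: 'X_[m]).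
split; last by rewrite [LHS]mpolyE (bigID (fun m => P (mdeg m + e)%N)).

  by apply: degs_sum => m Pm m' /msuppZ_le; rewrite msuppX inE => /eqP->.
by apply: degs_sum => m Pm m' /msuppZ_le; rewrite msuppX inE => /eqP->.
Qed.

Lemma degs_homog j p : degs (pred1 j) 0 p <-> p \is j.-homog.
Proof.
split=> [h|/dhomogP h m /h <-]; last by rewrite /= addn0.
by apply/dhomogP => m /h; rewrite addn0 => /eqP.
Qed.

End Kill.

(** * Complexes of free modules, modulo variables *)

Section Complex.
Variables (k : fieldType) (n : nat) (F : free_complex k n).
Local Notation S := {mpoly k[n]}.
Local Notation rk := (fr_rank F).
Local Notation D := (fr_diff F).
Hypothesis grF : is_graded F.
Hypothesis DD : forall i (v : 'rV_(rk i.+2)), v *m D i.+1 *m D i = 0.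
Implicit Types (V : seq 'I_n).

Local Notation killv V := (map_mx (kill V)).

Lemma killvD V r c (v w : 'M[S]_(r, c)) : killv V (v + w) = killv V v + killv V w.
Proof. exact: map_mxD. Qed.
Lemma killvB V r c (v w : 'M[S]_(r, c)) : killv V (v - w) = killv V v - killv V w.
Proof. exact: map_mxB. Qed.
Lemma killvZ V r c p (v : 'M[S]_(r, c)) : killv V (p *: v) = kill V p *: killv V v.
Proof. exact: map_mxZ. Qed.
Lemma killvM V r s c (v : 'M[S]_(r, s)) (w : 'M[S]_(s, c)) :
  killv V (v *m w) = killv V v *m killv V w.
Proof. exact: map_mxM. Qed.
Lemma killv_id V r c (v : 'M[S]_(r, c)) : killv V (killv V v) = killv V v.
Proof. by apply/matrixP => i j; rewrite !mxE kill_id. Qed.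
Lemma killv_nil r c (v : 'M[S]_(r, c)) : killv [::] v = v.
Proof. by apply/matrixP => i j; rewrite !mxE kill_nil. Qed.
Lemma killv_cons z V r c (v : 'M[S]_(r, c)) :
  killv (z :: V) (killv V v) = killv (z :: V) v.
Proof. by apply/matrixP => i j; rewrite !mxE kill_cons. Qed.

Lemma scaleX_inj z r c (v w : 'M[S]_(r, c)) :
  'X_z *: v = 'X_z *: w -> v = w.
Proof.
move=> e; apply/matrixP => i j; have := congr1 (fun M : 'M_(r, c) => M i j) e.
by rewrite !mxE; apply: mulfI; rewrite -msize_poly_eq0 msizeX.
Qed.

Definition degsv (P : pred nat) i (v : 'rV[S]_(rk i)) :=
  forall t, degs P (fr_deg t) (v 0 t).

Lemma degsvB P i (v w : 'rV[S]_(rk i)) :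
  degsv P v -> degsv P w -> degsv P (v - w).
Proof. by move=> hv hw t; rewrite !mxE; apply: degsD => //; apply: degsN. Qed.

Lemma degsv_mulX P i z (v : 'rV[S]_(rk i)) :
  degsv (fun j => P j.+1) v -> degsv P ('X_z *: v).
Proof. by move=> hv t; rewrite mxE; apply/degs_mulX. Qed.

Lemma degsv_diff P i (v : 'rV[S]_(rk i.+1)) : degsv P v -> degsv P (v *m D i).
Proof.
move=> hv u; rewrite mxE; apply: degs_sum => t _.
have [->|nz] := eqVneq (D i t u) 0; first by rewrite mulr0; apply: degs0.
have [e et hom] := (proj2 grF) i t u nz.
by apply: degs_mulr hom; rewrite -et.
Qed.

Lemma degsv_kill P V i (v : 'rV[S]_(rk i)) : degsv P v -> degsv P (killv V v).
Proof. by move=> hv t; rewrite mxE; apply: degs_kill. Qed.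

Lemma degsv_compl P i (v : 'rV[S]_(rk i)) :
  degsv P v -> degsv (predC P) v -> v = 0.
Proof.
by move=> h1 h2; apply/rowP => t; rewrite [RHS]mxE; apply: degs_compl (h1 t) (h2 t).
Qed.

Lemma degsv_split P i (v : 'rV[S]_(rk i)) :
  exists v1 v2, [/\ degsv P v1, degsv (predC P) v2 & v = v1 + v2].
Proof.
have /fin_all_exists[f hf] : forall t : 'I_(rk i), exists p1,
    exists p2, [/\ degs P (fr_deg t) p1, degs (predC P) (fr_deg t) p2 &
                v 0 t = p1 + p2] by move=> t; apply: degs_split.
have /fin_all_exists[g hg] := hf.
exists (\row_t f t), (\row_t g t).
by split=> [t|t|]; [| |apply/rowP => t]; rewrite !mxE; have [] := hg t.
Qed.

Local Notation hom j := (degsv (pred1 j)).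

(** In homological degree [0] every element is a cycle: the augmentation is not
    part of the complex whose homology is studied. *)
Definition is_cycle V i : 'rV[S]_(rk i) -> Prop :=
  match i with
  | 0 => fun=> True
  | i'.+1 => fun v => killv V (v *m D i') = 0
  end.

Definition is_boundary V i (v : 'rV[S]_(rk i)) : Prop :=
  exists w, killv V v = killv V (w *m D i).

Definition exact_at V i j : Prop :=
  forall v : 'rV[S]_(rk i), hom j v -> is_cycle V v -> is_boundary V v.

(** The homogeneous component of [w] of the right degree still has boundary
    [v], as the other components contribute to other degrees. *)
Lemma hom_boundary V i j (v : 'rV[S]_(rk i)) :
  hom j v -> is_boundary V v ->
  exists2 w : 'rV[S]_(rk i.+1), hom j w & killv V v = killv V (w *m D i).
Proof.
move=> hv [w ew]; have [w1 [w2 [h1 h2 e]]] := degsv_split (pred1 j) w.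
exists w1 => //; apply/eqP; rewrite -subr_eq0; apply/eqP.
apply: (@degsv_compl (pred1 j)).
  by apply: degsvB; apply: degsv_kill => //; apply: degsv_diff.
rewrite ew e mulmxDl killvD addrC addKr.
by apply: degsv_kill; apply: degsv_diff.
Qed.

Lemma killv_div z V r c (v : 'M[S]_(r, c)) : killv (z :: V) v = 0 ->
  exists u, killv V v = 'X_z *: u.
Proof.
move=> v0.
have /fin_all_exists[f hf] : forall ij : 'I_r * 'I_c, exists q,
    kill V (v ij.1 ij.2) = 'X_z * q.
  move=> ij; apply: kill_cons_div.
  by have := congr1 (fun M : 'M_(r, c) => M ij.1 ij.2) v0; rewrite !mxE.
exists (\matrix_(i, j) f (i, j)); apply/matrixP => i j.
by rewrite !mxE (hf (i, j)).
Qed.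

(** The connecting map [H_(i+1) (F/(z,V)) -> H_i (F/V)(-1)] of the long exact
    sequence of multiplication by [z], at the level of representatives. *)
Lemma connecting z V i (v : 'rV[S]_(rk i.+1)) :
  z \notin V -> is_cycle (z :: V) v ->
  exists u : 'rV[S]_(rk i),
    [/\ is_cycle V u, killv V (v *m D i) = 'X_z *: killv V u &
        forall P, degsv P v -> degsv (fun j => P j.+1) u].
Proof.
move=> zV /= /killv_div[u eu].
have eu' : killv V (v *m D i) = 'X_z *: killv V u.
  by rewrite -killv_id eu killvZ kill_var (negPf zV).
exists u; split=> // [|P hv t]; last first.
  apply/(degs_mulX _ _ z).
  have : degsv P (killv V (v *m D i)) by apply: degsv_kill; apply: degsv_diff.
  by move/(_ t); rewrite eu mxE.
case: i v u eu eu' => [//|i] v u eu eu' /=.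
apply: (@scaleX_inj z); rewrite scaler0.
by rewrite killvM scalemxAl -eu' -killvM DD map_mx0.
Qed.

(** If the image [u] of [v] under the connecting map is a boundary, then [v]
    can be corrected into a cycle of [F/V]. *)
Lemma lift_cycle z V i (v : 'rV[S]_(rk i.+1)) u w :
  z \notin V -> killv V (v *m D i) = 'X_z *: killv V u ->
  killv V u = killv V (w *m D i) -> is_cycle V (v - 'X_z *: w).
Proof.
move=> zV ev eu /=.
by rewrite mulmxBl killvB ev eu -scalemxAl killvZ kill_var (negPf zV) subrr.
Qed.

Lemma boundary_cons z V i p (v w : 'rV[S]_(rk i)) :
  is_boundary V (p *: (v - 'X_z *: w)) -> is_boundary (z :: V) (p *: v).
Proof.
case=> x ex; exists x; rewrite -[RHS]killv_cons -ex killv_cons.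
rewrite !killvZ killvB killvZ kill_var inE eqxx scale0r subr0 //.
Qed.

Lemma exact_up0 z V j : exact_at V 0 j -> exact_at (z :: V) 0 j.
Proof.
move=> ex v hv _; rewrite -[v]scale1r; apply: (@boundary_cons _ _ _ _ _ 0).
by rewrite scale1r scaler0 subr0; apply: ex.
Qed.

(** Exactness of [H_(i+1) (F/V) -> H_(i+1) (F/(z,V)) -> H_i (F/V)(-1)] at the
    middle term. *)
Lemma exact_up z V i j : z \notin V ->
  exact_at V i.+1 j.+1 -> exact_at V i j -> exact_at (z :: V) i.+1 j.+1.
Proof.
move=> zV ex1 ex0 v hv cv.
have [u [cu eu hu]] := connecting zV cv.
have {}hu : hom j u by apply: hu hv.
have [w hw ew] := hom_boundary hu (ex0 u hu cu).
rewrite -[v]scale1r; apply: (@boundary_cons _ _ _ _ _ w).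
rewrite scale1r; apply: ex1; last exact: lift_cycle eu ew.
by apply: degsvB => //; apply: degsv_mulX; apply: hw.
Qed.

(** Exactness of [H_(i+1) (F/(z,V)) -> H_i (F/V)(-1) -> H_i (F/V)]: the second
    map, multiplication by [z], is injective wherever the first term vanishes. *)
Lemma boundary_divX z V i j (v : 'rV[S]_(rk i)) :
  z \notin V -> exact_at (z :: V) i.+1 j.+1 -> hom j v ->
  is_boundary V ('X_z *: v) -> is_boundary V v.
Proof.
move=> zV ex hv bv.
have hzv : hom j.+1 ('X_z *: v) by apply: degsv_mulX; apply: hv.
have [w hw ew] := hom_boundary hzv bv.
have [] := ex w hw.
  by rewrite /= -killv_cons -ew killv_cons killvZ kill_var inE eqxx scale0r.
move=> w' ew'.
have /killv_div[u eu] : killv (z :: V) (w - w' *m D i.+1) = 0.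
  by rewrite killvB ew' subrr.
exists u; apply: (@scaleX_inj z).
transitivity (killv V ('X_z *: v)); first by rewrite killvZ kill_var (negPf zV).
rewrite ew -[w *m _]subr0 -(DD w') -mulmxBl [LHS]killvM -[killv V (w - _)]killv_id eu killvZ.
by rewrite kill_var (negPf zV) -scalemxAl -killvM.
Qed.

Lemma boundary_divXn z V i j N (v : 'rV[S]_(rk i)) :
  z \notin V -> (forall j', (j <= j')%N -> exact_at (z :: V) i.+1 j'.+1) ->
  hom j v -> is_boundary V ('X_z ^+ N *: v) -> is_boundary V v.
Proof.
move=> zV ex; elim: N j v ex => [|N IH] j v ex hv.
  by rewrite expr0 scale1r.
rewrite exprSr -scalerA => bv.
apply: (boundary_divX zV (ex j (leqnn j)) hv).
apply: (IH j.+1) bv; first by move=> j' jj'; apply: ex; apply: ltnW.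
by apply: degsv_mulX; apply: hv.
Qed.

(** A power of [x] annihilates the [i]-th homology module of [F/V]. *)
Definition nilpotent_at x V i : Prop :=
  exists N, forall v : 'rV[S]_(rk i),
    is_cycle V v -> is_boundary V ('X_x ^+ N *: v).

Lemma nilpotent_up0 x z V : nilpotent_at x V 0 -> nilpotent_at x (z :: V) 0.
Proof.
case=> N nil; exists N => v _; apply: (@boundary_cons _ _ _ _ _ 0).
by rewrite scaler0 subr0; apply: nil.
Qed.

(** The homology of [F/(z,V)] in degree [i + 1] is an extension of a submodule
    of [H_i (F/V)] by a quotient of [H_(i+1) (F/V)]. *)
Lemma nilpotent_up x z V i : z \notin V ->
  nilpotent_at x V i -> nilpotent_at x V i.+1 -> nilpotent_at x (z :: V) i.+1.
Proof.
move=> zV [N nil] [N' nil']; exists (N' + N)%N => v cv.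
have [u [cu eu _]] := connecting zV cv.
have [w ew] := nil u cu.
rewrite exprD -scalerA; apply: (@boundary_cons _ _ _ _ _ w).
apply: nil'; apply: lift_cycle ew => //.
by rewrite -scalemxAl !killvZ eu !scalerA mulrC.
Qed.

Lemma exact_up_seq L V m : uniq (L ++ V) ->
  (forall i j, (m + i < j)%N -> exact_at V i j) ->
  forall i j, (m + i < j)%N -> exact_at (L ++ V) i j.
Proof.
elim: L => [//|z L IH] /= /andP[zLV uLV] ex.
move=> [|i] [|j] // ij; first by apply: exact_up0; apply: IH.
by apply: exact_up => //; apply: IH => //; rewrite addnS ltnS in ij.
Qed.

Lemma nilpotent_up_seq x L V : uniq (L ++ V) ->
  (forall i, nilpotent_at x V i) -> forall i, nilpotent_at x (L ++ V) i.
Proof.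
elim: L => [//|z L IH] /= /andP[zLV uLV] nil [|i].
  by apply: nilpotent_up0; apply: IH.
by apply: nilpotent_up => //; apply: IH.
Qed.

(** Vanishing goes down from [F/(L,V)] to [F/V] one variable at a time.
    Nilpotency is needed on every intermediate complex, and is carried up from
    [F/V] to them. *)
Lemma exact_down_seq L V m : uniq (L ++ V) ->
  (forall x i, x \in L -> nilpotent_at x V i) ->
  (forall i j, (m + i < j)%N -> exact_at (L ++ V) i j) ->
  forall i j, (m + i < j)%N -> exact_at V i j.
Proof.
elim: L => [//|z L IH] /= /andP[zLV uLV] nil ex.
apply: IH => // [x i xL|i j ij v hv cv].
  by apply: nil; rewrite inE xL orbT.
have nilz i' : nilpotent_at z V i' by apply: nil; rewrite inE eqxx.
have [N nilN] := nilpotent_up_seq uLV nilz i.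
apply: (boundary_divXn zLV _ hv (nilN v cv)) => j' jj'.
by apply: ex; rewrite addnS ltnS; apply: leq_trans jj'.
Qed.

(** With all variables set to zero, only scalars survive, and an element of
    degree above those of the generators has no scalar coordinate. *)
Lemma exact_of_degree_le V m : (forall i, i \in V) ->
  (forall i (t : 'I_(rk i)), fr_deg t <= m + i)%N ->
  forall i j, (m + i < j)%N -> exact_at V i j.
Proof.
move=> allV degF i j ij v hv _; exists 0; rewrite mul0mx.
apply/rowP => t; rewrite !mxE rmorph0 kill_all //.
apply/eqP/negPn/negP; rewrite -mcoeff_msupp => /hv /=.
by rewrite mdeg0 add0n => /eqP e; have := degF i t; rewrite e leqNgt ij.
Qed.

(** With all variables set to zero, a basis vector is a cycle by minimality. In
    the range of the hypothesis it would be a boundary, but boundaries are [0], again by minimality. *)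
Lemma degree_le_of_exact V m : is_minimal F -> (forall i, i \in V) ->
  (forall i j, (m + i < j)%N -> exact_at V i j) ->
  forall i (t : 'I_(rk i)), (fr_deg t <= m + i)%N.
Proof.
move=> minF allV ex i t; rewrite leqNgt; apply/negP => lt.
have [||w /(congr1 (fun v : 'rV[S]_(rk i) => (v 0 t)@_0))] :=
    ex i _ lt (delta_mx 0 t).
- move=> u m'; rewrite mxE eqxx; case: eqP => [->|_]; last by rewrite msupp0.
  by rewrite msupp1 inE => /eqP->; rewrite mdeg0 /= add0n.
- case: i t lt => [//|i] t lt /=.
  rewrite -rowE; apply/rowP => u; rewrite !mxE.
  by apply: kill_all => //; apply: minF.
rewrite !mxE !eqxx rmorph1 mcoeff1 eqxx kill_constcoef raddf_sum /= big1.
  by move/eqP; rewrite oner_eq0.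
by move=> u _; rewrite rmorphM /= minF mulr0.
Qed.

End Complex.

(** * The resolution of the coordinate ring modulo two variables *)

Section Resolution.
Variables (k : fieldType) (n d : nat) (a : n.-tuple nat).
Hypothesis d_gt0 : (0 < d)%N.
Hypothesis leAd : forall i, (tnth a i <= d)%N.
Variables (Y Z : 'I_n).
Hypothesis YZ : Z != Y.
Hypothesis aY : tnth a Y = 0%N.
Hypothesis aZ : tnth a Z = d.

Local Notation S := {mpoly k[n]}.
Local Notation I := (toric_ideal k a d).

Variable F : free_complex k n.
Hypothesis grF : is_graded F.
Hypothesis resF : is_resolution I F.

Local Notation rk := (fr_rank F).
Local Notation D := (fr_diff F).
Local Notation hom j := (degsv (pred1 j)).
Local Notation killv V := (map_mx (kill V)).

Definition aug (v : 'rV[S]_(rk 0)) : S := (v *m fr_aug F) 0 0.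

Lemma augB v w : aug (v - w) = aug v - aug w.
Proof. by rewrite /aug mulmxBl !mxE. Qed.

Lemma augD v w : aug (v + w) = aug v + aug w.
Proof. by rewrite /aug mulmxDl !mxE. Qed.

Lemma augZ p v : aug (p *: v) = p * aug v.
Proof. by rewrite /aug -scalemxAl !mxE. Qed.

Lemma aug_onto p : exists v, I (p - aug v).
Proof. by have [onto _ _] := resF; apply: onto. Qed.

Lemma aug_ker v : I (aug v) <-> exists w, v = w *m D 0.
Proof. by have [_ ker _] := resF; apply: ker. Qed.

Lemma diff_diff i (v : 'rV[S]_(rk i.+2)) : v *m D i.+1 *m D i = 0.
Proof. by have [_ _ ex] := resF; apply/ex; exists v. Qed.

Lemma aug_degs P v : degsv P v -> degs P 0 (aug v).
Proof.
move=> hv; rewrite /aug mxE; apply: degs_sum => t _.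
by apply: degs_mulr (proj1 grF t); rewrite addn0; apply: hv.
Qed.

(** The ideal being homogeneous, the homogeneous component of a preimage is
    again a preimage. *)
Lemma aug_onto_homog j p : p \is j.-homog ->
  exists2 v, hom j v & I (p - aug v).
Proof.
move=> hp; have [v /(toricP d_gt0 leAd) iv] := aug_onto p.
have [v1 [v2 [h1 h2 ev]]] := degsv_split (pred1 j) v.
exists v1 => //; apply: (homog_toricP d_gt0 leAd (s := j)) => [|x].
  by apply: rpredB => //; apply/degs_homog; apply: aug_degs.
apply: contraTeq isT => nz.
have := iv j x; rewrite ev augD opprD addrA bicoefB.
suff -> : bicoef a j x (aug v2) = 0 by rewrite subr0 => /eqP; rewrite (negPf nz).
apply: contraTeq isT => /bicoef_neq0[m [/(aug_degs h2)]] /=.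
by rewrite addn0 => /eqP.
Qed.

Lemma exact_nil i (v : 'rV[S]_(rk i.+1)) : is_cycle [::] v -> is_boundary [::] v.
Proof.
have [_ _ ex] := resF.
by rewrite /= killv_nil => /ex[w ->]; exists w.
Qed.

(** The variable [y] is a nonzerodivisor on the coordinate ring, so [F/y]
    resolves its quotient by [y]. *)
Lemma exact_Y i (v : 'rV[S]_(rk i.+1)) : is_cycle [:: Y] v -> is_boundary [:: Y] v.
Proof.
move=> cv; have [u [cu eu _]] := connecting grF diff_diff (isT : Y \notin [::]) cv.
have [w ew] : is_boundary [::] u.
  case: i v cv u cu eu => [|i] v cv u cu eu; last exact: exact_nil.
  suff /aug_ker[w ->] : I (aug u) by exists w.
  apply: (toric_mulX_inv d_gt0 leAd (m := U_(Y))).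
  rewrite -augZ; apply/aug_ker; exists v.
  by move: eu; rewrite !killv_nil.
rewrite -[v]scale1r; apply: (@boundary_cons _ _ _ _ _ _ _ _ w); rewrite scale1r.
by apply: exact_nil; apply: lift_cycle eu ew.
Qed.

Lemma ZnY : Z \notin [:: Y]. Proof. by rewrite inE. Qed.

(** As [F/y] is exact in positive degrees, setting [z] to zero creates homology
    in degrees [0] and [1] only. *)
Lemma exact_ZY_high i (v : 'rV[S]_(rk i.+2)) :
  is_cycle [:: Z; Y] v -> is_boundary [:: Z; Y] v.
Proof.
move=> cv; have [u [cu eu _]] := connecting grF diff_diff ZnY cv.
have [w ew] := exact_Y cu.
rewrite -[v]scale1r; apply: (@boundary_cons _ _ _ _ _ _ _ _ w); rewrite scale1r.
by apply: exact_Y; apply: lift_cycle eu ew; apply: ZnY.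
Qed.

(** The class of [v] in [H_1 (F/(y,z))] is determined by its image in the
    quotient of the coordinate ring by [y], represented by [aug u]: it vanishes
    as soon as [aug u] is a multiple of [y]. *)
Lemma boundary_ZY_1 (v : 'rV[S]_(rk 1)) (u : 'rV[S]_(rk 0)) q :
  killv [:: Y] (v *m D 0) = 'X_Z *: killv [:: Y] u ->
  I (aug u - 'X_Y * q) -> is_boundary [:: Z; Y] v.
Proof.
move=> eu iu; have [v' iv'] := aug_onto q.
have /aug_ker[w ew] : I (aug (u - 'X_Y *: v')).
  rewrite augB augZ.
  have -> : aug u - 'X_Y * aug v' =
    (aug u - 'X_Y * q) + 'X_Y * (q - aug v') by ring.
  by apply: toricD => //; apply: toricM.
rewrite -[v]scale1r; apply: (@boundary_cons _ _ _ _ _ _ _ _ w); rewrite scale1r.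
apply: exact_Y; apply: lift_cycle eu _; first exact: ZnY.
by rewrite -ew killvB killvZ kill_var inE eqxx scale0r subr0.
Qed.

Lemma exact_ZY_0_of_reduction j :
  (forall x, x \in sums a j.+1 ->
     x \in sums a j \/ (d <= x /\ x - d \in sums a j)%N) ->
  exact_at F [:: Z; Y] 0 j.+1.
Proof.
move=> red v hv _.
have hp : aug v \is j.+1.-homog by apply/degs_homog; apply: aug_degs.
have [q1 [q2 iq]] := toric_divYZ d_gt0 leAd aY aZ hp red.
have [v1 i1] := aug_onto q1; have [v2 i2] := aug_onto q2.
have /aug_ker[w ew] : I (aug (v - ('X_Y *: v1 + 'X_Z *: v2))).
  rewrite augB augD !augZ.
  have -> : aug v - ('X_Y * aug v1 + 'X_Z * aug v2) =
     (aug v - ('X_Y * q1 + 'X_Z * q2)) +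
     ('X_Y * (q1 - aug v1) + 'X_Z * (q2 - aug v2)).
    by ring.
  by apply: toricD => //; apply: toricD; apply: toricM.
exists w; rewrite -ew killvB killvD !killvZ !kill_var !inE !eqxx orbT.
by rewrite !scale0r addr0 subr0.
Qed.

(** [H_1 (F/(y,z))] in degree [s + 2] is the kernel of [z] on the degree [s + 1]
    part of the quotient by [y]. *)
Lemma exact_ZY_1_of_injective s :
  (forall x, x \in sums a s.+1 -> (d + x)%N \in sums a s.+1 -> x \in sums a s) ->
  exact_at F [:: Z; Y] 1 s.+2.
Proof.
move=> inj v hv cv; have [u [_ eu hu]] := connecting grF diff_diff ZnY cv.
have {hu} hu : hom s.+1 u by apply: hu hv.
have hp : aug u \is s.+1.-homog by apply/degs_homog; apply: aug_degs.
have [u' eu'] : exists u', killv [::] (v *m D 0 - 'X_Z *: u) = 'X_Y *: u'.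
  apply: killv_div; rewrite killvB killvZ eu kill_var (negPf ZnY) subrr //.
have isum : I ('X_Z * aug u + 'X_Y * aug u').
  rewrite -!augZ -augD -eu' killv_nil addrC subrK.
  by apply/aug_ker; exists v.
have [q iq] : exists q, I (aug u - 'X_Y * q).
  apply: (toric_divY d_gt0 leAd aY hp) => x nz.
  apply: inj; first exact: bicoef_sums nz.
  have /(toricP d_gt0 leAd) := isum => /(_ s.+2 (d + x)%N).
  rewrite bicoefD (bicoef_mulZ aZ) (bicoef_mulY aY) leq_addr addKn => e.
  apply: (@bicoef_sums k _ _ _ _ (aug u')); apply: contraNneq nz => u'0.
  by rewrite -e u'0 addr0.
exact: boundary_ZY_1 eu iq.
Qed.

(** In the coordinate ring [x^d = y^(d-a) z^a], where [a < d] is the integer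
    attached to the variable [x]. *)
Lemma power_in_Y x : (tnth a x < d)%N ->
  exists q : S, I ('X_x ^+ d - 'X_Y * q).
Proof.
move=> xd.
exists ('X_[U_(Y) *+ (d - tnth a x).-1 + U_(Z) *+ tnth a x]).
rewrite mpolyXn -mpolyXD; apply: toric_binom => //.
  rewrite !mdegD !mdegMn !mdeg1 !mul1n addnA add1n prednK ?subn_gt0 //.
  by rewrite subnK // ltnW.
rewrite !mweightD mweightU aY.
by rewrite !mweightMn !mweightU aY aZ muln0 !add0n mulnC.
Qed.

Lemma nilpotent_ZY x i : (tnth a x < d)%N -> nilpotent_at F x [:: Z; Y] i.
Proof.
move=> xd; case: i => [|[|i]]; last first.
- by exists 0%N => v cv; rewrite expr0 scale1r; apply: exact_ZY_high.
- have [q iq] := power_in_Y xd; exists d => v cv.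
  have [u [_ eu _]] := connecting grF diff_diff ZnY cv.
  apply: (@boundary_ZY_1 _ ('X_x ^+ d *: u) (q * aug u)).
    by rewrite -scalemxAl !killvZ eu !scalerA mulrC.
  by rewrite augZ mulrA -mulrBl mulrC; apply: toricM.
have [q iq] := power_in_Y xd; exists d => v _.
have /aug_ker[w ew] : I (aug ('X_x ^+ d *: v - 'X_Y *: (q *: v))).
  by rewrite augB !augZ mulrA -mulrBl mulrC; apply: toricM.
exists w; rewrite -ew killvB [killv _ ('X_Y *: _)]killvZ kill_var !inE eqxx orbT.
by rewrite scale0r subr0.
Qed.

(** The converse of [exact_ZY_0_of_reduction]: apply the vanishing of
    [H_0 (F/(y,z))] to a monomial of weight [x] and read off the coordinate at
    [x]. *)
Lemma sums_reduction_of_exact j x : exact_at F [:: Z; Y] 0 j.+1 -> x \in sums a j.+1 ->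
  x \in sums a j \/ (d <= x /\ x - d \in sums a j)%N.
Proof.
move=> ex /sums_mnm[m mj mx].
have [v hv iv] : exists2 v, hom j.+1 v & I ('X_[m] - aug v).
  by apply: aug_onto_homog; rewrite dhomogX; apply/eqP.
have [w ew] := ex v hv Logic.I.
have /killv_div[u2 e2] : killv [:: Z; Y] (v - w *m D 0) = 0.
  by rewrite killvB ew subrr.
have [u1 e1] : exists u1,
    killv [::] (v - w *m D 0 - 'X_Z *: killv [:: Y] u2) = 'X_Y *: u1.
  apply: killv_div; rewrite killvB killvZ killv_id kill_var (negPf ZnY).
  by rewrite -killv_id e2 killvZ kill_var (negPf ZnY) subrr.
set u3 := killv [:: Y] u2 in e1.
have iw : I (aug (w *m D 0)) by apply/aug_ker; exists w.
have : I ('X_[m] - ('X_Z * aug u3 + 'X_Y * aug u1)).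
  rewrite -!augZ -e1 killv_nil -augD [X in aug X]addrC subrK augB opprB addrA addrAC.
  by apply: toricD.
move=> /(toricP d_gt0 leAd) /(_ j.+1 x).
rewrite bicoefB bicoefD (bicoef_mulZ aZ) (bicoef_mulY aY) bicoefX mj mx !eqxx /=.
move=> e.
have [z1|nz] := eqVneq (bicoef a j x (aug u1)) 0; last first.
  by left; apply: bicoef_sums nz.
right; move: e; rewrite z1 addr0; case: leqP => [dx e|_ /eqP].
  split=> //; apply: (@bicoef_sums k _ _ _ _ (aug u3)).
  by apply: contra_eq_neq e => ->; rewrite subr0 oner_neq0.
by rewrite subr0 oner_eq0.
Qed.

(** The converse of [exact_ZY_1_of_injective]. If [p] and [p'] are monomials of
    degree [s + 1] and weights [x] and [d + x], then [z p = y p'] in the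
    coordinate ring, so [z] kills [p] modulo [y]. Hence [p] is a multiple of
    [y]. *)
Lemma sums_injective_of_exact s x : exact_at F [:: Z; Y] 1 s.+2 ->
  x \in sums a s.+1 -> (d + x)%N \in sums a s.+1 -> x \in sums a s.
Proof.
move=> ex /sums_mnm[m ms mx] /sums_mnm[m' ms' mx'].
have [v hv iv] : exists2 v, hom s.+1 v & I ('X_[m] - aug v).
  by apply: aug_onto_homog; rewrite dhomogX; apply/eqP.
have [v' _ iv'] : exists2 v, hom s.+1 v & I ('X_[m'] - aug v).
  by apply: aug_onto_homog; rewrite dhomogX; apply/eqP.
have imm : I ('X_Z * 'X_[m] - 'X_Y * 'X_[m']).
  rewrite -!mpolyXD; apply: toric_binom => //.
    by rewrite !mdegD !mdeg1 ms ms'.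
  by rewrite !mweightD !mweightU aY aZ mx mx'.
have /aug_ker[w ew] : I (aug ('X_Z *: v - 'X_Y *: v')).
  rewrite augB !augZ.
  have -> : 'X_Z * aug v - 'X_Y * aug v' = ('X_Z * 'X_[m] - 'X_Y * 'X_[m'])
     - ('X_Z * ('X_[m] - aug v) - 'X_Y * ('X_[m'] - aug v')).
    by ring.
  by apply: toricB => //; apply: toricB; apply: toricM.
have [u eu] : is_boundary [:: Y] v.
  apply: (boundary_divX grF diff_diff ZnY ex hv); exists w.
  by rewrite -ew killvB [killv _ ('X_Y *: _)]killvZ kill_var inE eqxx scale0r subr0.
have [u1 e1] : exists u1, killv [::] (v - u *m D 0) = 'X_Y *: u1.
  by apply: killv_div; rewrite killvB eu subrr.
have iu : I (aug (u *m D 0)) by apply/aug_ker; exists u.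
have : I ('X_[m] - 'X_Y * aug u1).
  rewrite -augZ -e1 killv_nil augB opprB addrA addrAC.
  by apply: toricD.
move=> /(toricP d_gt0 leAd) /(_ s.+1 x).
rewrite bicoefB (bicoef_mulY aY) bicoefX ms mx !eqxx /= => e.
apply: (@bicoef_sums k _ _ _ _ (aug u1)).
by apply: contra_eq_neq e => ->; rewrite subr0 oner_neq0.
Qed.

End Resolution.

(** * The Hilbert function and the theorem *)

Lemma poly_eq_from (P Q : {poly rat}) N :
  (forall t, (N <= t)%N -> P.[t%:R] = Q.[t%:R]) -> P = Q.
Proof.
move=> PQ; apply/eqP; rewrite -subr_eq0; apply/eqP.
apply: (@roots_geq_poly_eq0 _ _ [seq (N + i)%:R | i <- iota 0 (size (P - Q))]).
- by apply/allP => _ /mapP[i _ ->]; rewrite rootE hornerD hornerN PQ ?subrr ?leq_addr.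
- rewrite map_inj_uniq ?iota_uniq // => i j /eqP.
  by rewrite eqr_nat eqn_add2l => /eqP.
by rewrite size_map size_iota.
Qed.

Section Hilbert.
Variables (k : fieldType) (n d : nat) (a : n.-tuple nat).
Hypothesis d_gt0 : (0 < d)%N.
Hypothesis leAd : forall i, (tnth a i <= d)%N.

Local Notation I := (toric_ideal k a d).

(** The matrix of the coordinates of the given basis on the monomials
    [u^x v^(sd-x)] is invertible, hence square. *)
Lemma quotient_dim_sums s h : quotient_dim I s h -> h = size (sums a s).
Proof.
case=> e he unique; set N := size (sums a s).
pose x_ (j : 'I_N) := nth 0%N (sums a s) j.
have x_in j : x_ j \in sums a s by apply: mem_nth.
pose E := \matrix_(t < h, j < N) bicoef a s (x_ j) (tnth e t).
pose p_ (w : 'rV[k]_N) :=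
  bicoef_lift a s predT (fun x => \sum_j w 0 j *+ (x_ j == x)).
have p_E w j : bicoef a s (x_ j) (p_ w) = w 0 j.
  rewrite /p_ bicoef_of_lift // x_in /= (bigD1 j) //= eqxx big1 ?addr0 //.
  move=> i ij; rewrite (nth_uniq _ _ _ (sums_uniq a s)) //.
  by rewrite -[(i == j :> nat)]/(i == j) (negPf ij).
have key w (c : 'rV_h) : I (p_ w - \sum_(t < h) c 0 t *: tnth e t) <-> w = c *m E.
  have cE j : bicoef a s (x_ j) (\sum_(t < h) c 0 t *: tnth e t) = (c *m E) 0 j.
    rewrite bicoef_sum mxE; apply: eq_bigr => t _.
    by rewrite bicoefZ mxE.
  split=> [/(toricP d_gt0 leAd) i0|ew].
    apply/rowP => j; rewrite -cE -p_E; apply/eqP; rewrite -subr_eq0 -bicoefB.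
    by rewrite i0.
  apply: (homog_toricP d_gt0 leAd (s := s)) => [|x].
    apply: rpredB; first exact: bicoef_lift_homog.
    by apply: rpred_sum => t _; apply: rpredZ; exact: he.
  apply: contraTeq isT => nz; have xs := bicoef_sums nz.
  have xN : (index x (sums a s) < N)%N by rewrite index_mem.
  move: nz; have <- : x_ (Ordinal xN) = x by rewrite /x_ nth_index.
  by rewrite bicoefB cE p_E ew subrr eqxx.
have full : row_full E.
  rewrite -sub1mx; apply/row_subP => i; apply/submxP.
  have [|c [/key ec _]] := unique (p_ (row i 1%:M)).
    exact: bicoef_lift_homog.
  by exists c.
have free : row_free E.
  apply: inj_row_free => v vE0.
  have [|c [_ uc]] := unique (p_ 0); first exact: bicoef_lift_homog.
  have <- : c = v by apply: uc; apply/key.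
  by apply: uc; apply/key; rewrite mul0mx.
by move: full free; rewrite /row_full /row_free => /eqP-> /eqP.
Qed.

(** The cardinal of the sumsets is affine from [m] on, by [size_sums_rec]; the
    polynomial [L] of this affine function coincides with the Hilbert
    polynomial, since they agree at all large integers. *)
Lemma hilbert_regularity_le_of_sums m (r : int) :
  0%N \in val a -> d \in val a ->
  (forall j x, (m <= j)%N -> x \in sums a j.+1 ->
     x \in sums a j \/ (d <= x /\ x - d \in sums a j)%N) ->
  (forall s x, (m <= s)%N -> x \in sums a s.+1 -> (d + x)%N \in sums a s.+1 ->
     x \in sums a s) ->
  is_hilbert_regularity I r -> r <= m%:Z.
Proof.
move=> a0 ad red inj [H [P [[hH _] _ agr minr]]].
have HE s : H s%:Z = size (sums a s) by apply: quotient_dim_sums.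
pose f s : rat := (size (sums a s))%:R.
pose L : {poly rat} := (f m.+1 - f m)%:P * ('X - m%:R%:P) + (f m)%:P.
have LE x : L.[x] = (f m.+1 - f m) * (x - m%:R) + f m.
  by rewrite hornerD hornerM !hornerC hornerXsubC.
have fL t : f (m + t)%N = L.[(m + t)%:R].
  suff [] : f (m + t)%N = L.[(m + t)%:R] /\ f (m + t.+1)%N = L.[(m + t.+1)%:R] by [].
  rewrite !LE; elim: t => [|t [IH1 IH2]].
    by rewrite addn0 addn1 -[m.+1]addn1 natrD; split; ring.
  split=> //; have mt : (m <= m + t)%N by apply: leq_addr.
  have := size_sums_rec a0 ad (fun x => red _ x (leqW mt)) (fun x => inj _ x mt).
  move=> /(congr1 (fun i : nat => i%:R : rat)).
  rewrite natrD natrM -!/(f _) -!addnS => /(canRL (addrK _)) ->.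
  rewrite IH1 IH2 !natrD -[t.+2]addn2 -[t.+1]addn1 !natrD; ring.
suff PL : P = L.
  apply: minr => s ms; rewrite PL.
  have -> : s = (m + `|s - m%:Z|)%N%:Z by lia.
  by rewrite HE -fL.
apply: (@poly_eq_from _ _ (m + `|r|)%N) => t mt.
rewrite -[t in RHS](@subnKC m) ?fL; last by lia.
by rewrite -fL subnKC ?/f -?HE; [rewrite agr //; lia | lia].
Qed.

End Hilbert.

Theorem theorem3p16 (k : fieldType) (n d : nat) (a : n.-tuple nat)
    (c1 c2 sigma : nat) (r reg : int) :
  infinite_field k ->
  (4 <= n)%N ->
  sorted ltn a ->
  head 0%N a = 0%N ->
  last 0%N a = d ->
  (\big[gcdn/0%N]_(1 <= i < n) nth 0%N a i)%N = 1%N ->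
  is_conductor (generated_semigroup a) c1 ->
  is_conductor (generated_semigroup (reflected d a)) c2 ->
  is_sumsets_regularity a d c1 c2 sigma ->
  is_hilbert_regularity (toric_ideal k a d) r ->
  is_castelnuovo_mumford_regularity (toric_ideal k a d) reg ->
  (sigma%:Z = r ->
   Num.ceil ((c1 + c2)%N%:R / d%:R : rat) <= r ->
   sigma%:Z <= reg /\ reg <= sigma%:Z + 1) /\
  (sigma%:Z = Num.ceil ((c1 + c2)%N%:R / d%:R : rat) ->
   r < sigma%:Z ->
   Num.ceil (sigma%:R / 2%:R : rat) + 1 <= reg /\ reg <= sigma%:Z + 1).
Proof.
move=> _ n4 sorted_a head_a last_a _ hc1 hc2 [hdec _] hilb.
move=> [beta [[F [grF resF minF] betaE] [i0 [j0 [b0 regE]]] maxreg]].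
have nth_lt i j : (i < j < n)%N -> (nth 0 a i < nth 0 a j)%N.
  case/andP=> ij jn; apply: (sorted_ltn_nth ltn_trans) => //;
  by rewrite inE size_tuple //; apply: ltn_trans jn.
have uA : uniq a by apply: sorted_uniq sorted_a; [exact: ltn_trans|exact: ltnn].
have Yn : (0 < n)%N by lia.
have Zn : (n.-1 < n)%N by lia.
pose Y := Ordinal Yn; pose Z := Ordinal Zn.
have YZ : Z != Y by rewrite -val_eqE /=; lia.
have aY : tnth a Y = 0%N by rewrite (tnth_nth 0) /= nth0.
have aZ : tnth a Z = d by rewrite (tnth_nth 0) /= -last_a -nth_last size_tuple.
have ltAd i : i != Z -> (tnth a i < d)%N.
  move=> iZ; rewrite -aZ !(tnth_nth 0); apply: nth_lt; rewrite Zn andbT /=.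
  by have := ltn_ord i; move: iZ; rewrite -val_eqE /=; lia.
have leAd i : (tnth a i <= d)%N.
  by have [->|/ltAd/ltnW //] := eqVneq i Z; rewrite aZ.
have leAd' : {in a, forall b, (b <= d)%N} by move=> b /tnthP[i ->].
have A0 : 0%N \in val a by rewrite -aY mem_tnth.
have Ad : d \in val a by rewrite -[X in X \in _]aZ mem_tnth.
have d1 : (1 < d)%N.
  have := nth_lt 0%N 1%N; have := nth_lt 1%N n.-1.
  have := aZ; rewrite (tnth_nth 0) /= => ->; lia.
have d0 : (0 < d)%N by lia.
have DD := diff_diff resF.
pose L := [seq i <- enum 'I_n | i \notin [:: Z; Y]].
have uL : uniq (L ++ [:: Z; Y]).
  rewrite cat_uniq filter_uniq ?enum_uniq //= !inE YZ.
  by rewrite !mem_filter !inE !eqxx !orbT.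
have allL i : i \in L ++ [:: Z; Y].
  by rewrite mem_cat mem_filter mem_enum andbT orNb.
have deg_le i (t : 'I_(fr_rank F i)) : (fr_deg t)%:Z - i%:Z <= reg.
  apply: maxreg; rewrite betaE -lt0n; apply/card_gt0P; exists t.
  by rewrite inE.
have upper : reg <= sigma%:Z + 1.
  have [t] : exists t : 'I_(fr_rank F i0), t \in [set t | fr_deg t == j0].
    by apply/card_gt0P; rewrite lt0n -betaE.
  rewrite inE => /eqP tj; rewrite regE -tj.
  suff : (fr_deg t <= sigma.+1 + i0)%N by lia.
  apply: (degree_le_of_exact minF allL) => {i0 j0 b0 regE t tj}.
  apply: exact_up_seq => // -[|[|i]] j ij.
  - case: j ij => [//|j] ij; apply: (exact_ZY_0_of_reduction d0 leAd aY aZ grF resF) => x.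
    by apply: (decomposition_reduction uA leAd' hc1 hc2 hdec); lia.
  - case: j ij => [|[|s]] ij; [lia|lia|].
    apply: (exact_ZY_1_of_injective d0 leAd YZ aY aZ grF resF) => x xs dxs.
    by apply: (decomposition_injective uA leAd' hc1 hc2 hdec (s := s.+1)) => //; lia.
  - by move=> v _; apply: (exact_ZY_high d0 leAd YZ grF resF).
(* The ring is nonzero, so [F_0] has a generator. *)
have reg0 : 0 <= reg.
  have [v] := aug_onto resF 1.
  have [t _|no] := pickP (fun t : 'I_(fr_rank F 0) => true).
    by have := deg_le _ t; lia.
  rewrite /aug mxE big1 ?subr0 => [|t _]; last by have := no t.
  by move/eqP; rewrite comp_mpoly1 => /eqP; rewrite oner_eq0.
pose m := `|reg|%N; have regm : reg = m%:Z by lia.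
have ex i j : (m + i < j)%N -> exact_at F [:: Z; Y] i j.
  apply: (exact_down_seq grF DD uL) => [x i' xL|i' j'].
    apply: (nilpotent_ZY d0 leAd YZ aY aZ grF resF); apply: ltAd.
    by move: xL; rewrite mem_filter !inE negb_or => /andP[/andP[]].
  apply: exact_of_degree_le => // i'' t; have := deg_le _ t; lia.
have red j x : (m <= j)%N -> x \in sums a j.+1 ->
    x \in sums a j \/ (d <= x /\ x - d \in sums a j)%N.
  move=> mj; apply: (sums_reduction_of_exact d0 leAd YZ aY aZ grF resF).
  by apply: ex; lia.
have inj s x : (m <= s)%N -> x \in sums a s.+1 -> (d + x)%N \in sums a s.+1 ->
     x \in sums a s.
  move=> ms; apply: (sums_injective_of_exact d0 leAd YZ aY aZ grF resF).
  by apply: ex; lia.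
have rm : r <= m%:Z := hilbert_regularity_le_of_sums d0 leAd A0 Ad red inj hilb.
split=> [sigma_r _|sigmaE _]; first by split=> //; rewrite regm sigma_r.
split=> //.
have b1 := conductor_le_of_reduction uA leAd' A0 Ad d0 hc1 red.
have b2 : (c2 + d <= m * d.-1 + 1)%N.
  apply: (conductor_le_of_reduction _ _ _ _ d0 hc2) => [||||j x mj].
  - exact: reflected_uniq.
  - exact: reflected_le.
  - by apply/mapP; exists d; rewrite ?subnn.
  - by apply/mapP; exists 0%N; rewrite ?subn0.
  - exact: (reflected_reduction leAd' red).
have m1 : (0 < m)%N.
  rewrite lt0n; apply/eqP => m0; move: b1; rewrite m0 mul0n; lia.
have c12 : (c1 + c2 <= (m.-1 * 2) * d)%N.
  by move: b1 b2; rewrite -(prednK m1) -(prednK d0) /=; nia.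
(* The bound is an integer, so it also bounds the ceiling sigma. *)
have sm : sigma%:Z <= (m.-1 * 2)%N%:Z.
  rewrite sigmaE ceil_le_int ler_pdivrMr ?ltr0n //.
  by rewrite -natrM ler_nat.
rewrite regm; suff : Num.ceil (sigma%:R / 2%:R : rat) <= m.-1%:Z by lia.
rewrite ceil_le_int ler_pdivrMr ?ltr0n // -natrM ler_nat; lia.
Qed.
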